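(* Let $k$ be an algebraically closed field. For all positive integers $c$, $d$ and $n$ there exist an integer $m$ and a non-zero non-commutative polynomial $P\in k\langle y_1,\ldots,y_m\rangle$ with the following property. If $Q\in k\langle x_1,\ldots,x_n\rangle$ is a non-commutative polynomial of degree $d$ in $n$ variables, and $R$ is any associative $k$-algebra such that $Q$ is a $c$-almost identity of $R$, then $P(r_1,\ldots,r_m)=0$ for all $r_1,\ldots,r_m\in R$.
   Context: $k$ is an algebraically closed field of arbitrary characteristic. Associative algebras are unital and possibly infinite-dimensional over $k$; $k\langle x_1,\ldots,x_n\rangle$ is the free associative (non-commutative polynomial) $k$-algebra with unit. Codimension: let $V$ be a (possibly infinite-dimensional) $k$-vector space and $A$ the ring of $k$-valued polynomial functions on $V$ (the $k$-algebra of functions generated by the constants and the linear functionals). For an ideal $I$ of $A$, $V(I)\subset V$ is the set of common zeros of the elements of $I$; an algebraic set in $V$ is a set of this form. An algebraic set $X\subset V$ has codimension $\le c$ if there exist a direct sum decomposition $V=V_1\oplus V_2$ with $V_2$ finite dimensional and an algebraic set $X_2\subset V_2$ of codimension at most $c$ in $V_2$ (in the usual sense, $\dim V_2-\dim X_2\le c$, the empty set having infinite codimension) such that $X\supset V_1\times X_2$. Almost identity: for an associative $k$-algebra $R$ and $Q\in k\langle x_1,\ldots,x_n\rangle$, let $e_Q\colon R^n\to R$ be the evaluation map. Then $e_Q^{-1}(0)$ is an algebraic set in $V=R^n$ (the common zero set of the polynomial functions $\alpha\circ e_Q$, $\alpha\in R^*$). A non-zero $Q$ is a $c$-almost identity of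 $R$ if $e_Q^{-1}(0)$ has codimension $\le c$ in $R^n$. *)

(* Defs.v *)
From HB Require Import structures.
From mathcomp Require Import all_boot all_order all_algebra.
From mathcomp Require Import monalg.
From mathcomp Require Import boolp classical_sets.
Set Implicit Arguments.
Unset Strict Implicit.
Unset Printing Implicit Defensive.
Import GRing.Theory.

Local Open Scope classical_set_scope.
Local Open Scope ring_scope.

Definition ncpoly (k : fieldType) (n : nat) := {malg k[{fmonom 'I_n}]}.

(* [mmeasure] is one more than the largest length of a word in the support,
   and 0 for the zero polynomial. *)
Definition has_degree (k : fieldType) (n : nat) (Q : ncpoly k n) (d : nat) :=
  mmeasure (@fdeg 'I_n) Q = d.+1.

Definition nc_eval (k : fieldType) (R : algType k) (n : nat)
    (Q : ncpoly k n) (r : 'I_n -> R) : R :=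
  mmap (in_alg R) (fun w : {fmonom 'I_n} => \prod_(i <- w) r i) Q.

Inductive polyfun (k : fieldType) (V : lmodType k) : (V -> k) -> Prop :=
| polyfun_cst (a : k) : polyfun (fun=> a)
| polyfun_lin (f : {scalar V}) : polyfun f
| polyfun_add (f g : V -> k) :
    polyfun f -> polyfun g -> polyfun (fun v => f v + g v)
| polyfun_mul (f g : V -> k) :
    polyfun f -> polyfun g -> polyfun (fun v => f v * g v).

Definition polyfun_ideal (k : fieldType) (V : lmodType k)
    (I : set (V -> k)) : Prop :=
  [/\ I `<=` @polyfun k V,
      I (fun=> 0),
      forall f g, I f -> I g -> I (fun v => f v + g v)
    & forall f g, polyfun f -> I g -> I (fun v => f v * g v)].

Definition zero_locus (k : fieldType) (V : lmodType k)
    (I : set (V -> k)) : set V :=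
  [set v | forall f, I f -> f v = 0].

Definition algebraic_set (k : fieldType) (V : lmodType k) (X : set V) : Prop :=
  exists2 I : set (V -> k), polyfun_ideal I & X = zero_locus I.

Definition irreducible_set (k : fieldType) (V : lmodType k)
    (X : set V) : Prop :=
  [/\ algebraic_set X, X !=set0
    & forall Y Z : set V, algebraic_set Y -> algebraic_set Z ->
        X = Y `|` Z -> X = Y \/ X = Z].

Definition irreducible_chain (k : fieldType) (V : lmodType k)
    (X : set V) (e : nat) : Prop :=
  exists Z : nat -> set V,
    (forall i, (i <= e)%N -> irreducible_set (Z i) /\ Z i `<=` X) /\
    (forall i, (i < e)%N -> Z i `<` Z i.+1).

(* Krull dimension for the Zariski topology; the empty set contains no
   irreducible chain, hence has no dimension. *)
Definition has_dim (k : fieldType) (V : lmodType k)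
    (X : set V) (e : nat) : Prop :=
  irreducible_chain X e /\
  forall e', irreducible_chain X e' -> (e' <= e)%N.

Definition fin_codim_le (k : fieldType) (W : vectType k)
    (X : set W) (c : nat) : Prop :=
  exists2 e : nat, has_dim X e & (\dim {:W} <= e + c)%N.

Definition subspace (k : fieldType) (V : lmodType k) (U : set V) : Prop :=
  U 0 /\ forall (a : k) u v, U u -> U v -> U (a *: u + v).

Definition direct_sum (k : fieldType) (V : lmodType k)
    (V1 V2 : set V) : Prop :=
  [/\ subspace V1, subspace V2
    & forall v, exists! p : V * V, [/\ V1 p.1, V2 p.2 & v = p.1 + p.2]].

(* The finite-dimensional summand V2 is presented as the image of a [vectType]
   W under an injective linear map, so that algebraic subsets of V2 and their
   dimension are taken in W. *)
Definition codim_le (k : fieldType) (V : lmodType k)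
    (X : set V) (c : nat) : Prop :=
  exists (V1 V2 : set V) (W : vectType k) (h : {linear W -> V}) (X2 : set W),
    [/\ direct_sum V1 V2,
        injective h /\ range h = V2,
        algebraic_set X2,
        fin_codim_le X2 c
      & forall v1 w, V1 v1 -> X2 w -> X (v1 + h w)].

Definition almost_identity (k : fieldType) (c n : nat)
    (Q : ncpoly k n) (R : algType k) : Prop :=
  Q <> 0 /\ codim_le [set r : {ffun 'I_n -> R} | nc_eval Q r = 0] c.

(* Main.v *)
Require Import Defs.
From HB Require Import structures.
From mathcomp Require Import all_boot all_order all_algebra all_fingroup.
From mathcomp Require Import finmap monalg.
From mathcomp Require Import boolp classical_sets functions.
Set Implicit Arguments.
Unset Strict Implicit.
Unset Printing Implicit Defensive.
Import GRing.Theory.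

Local Open Scope ring_scope.

(** Let [m = (c + 1) n].  The identity [P] is the standard polynomial (the
    alternating sum over all orders of multiplication) of the family of all words
    of length [d] in [m] letters.  It does not depend on [Q], it is nonzero in the
    free algebra because concatenations of words of equal length can be cut back,
    and it vanishes at [r] as soon as the values at [r] of the words of length [d]
    are linearly dependent ([standard_sum_dependent]).  So everything rests on
    [words_dependent]: if [Q] has degree [d] and is a [c]-almost identity of [R],
    then the words of length [d] in any [m] elements of [R] are dependent.

    To see this, arrange the [m] elements as vectors [v_0, ..., v_c] of [R^n], and
    restrict [Q] to the points [h s + \sum_i tau_i v_i], where [h] embeds the finite
    dimensional summand [W], and the coordinates of [s] in [W] and the [tau_i] are
    the variables.  If the words were independent, then for each [i] a linear
    functional on [R] could isolate the word obtained from [v_i] by following a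
    word of length [d] that occurs in [Q]; its composite with [Q] has the form
    [a tau_i^d + (terms of degree at most d, and of degree less than d in tau)]
    with [a <> 0] ([power_in_low_monomials]).  On the zero set these polynomials
    vanish, so there every function of degree at most [L] is a combination of
    monomials in which all [tau_i] have exponents below [d]
    ([degree_span_reduce]): these functions span a space of dimension
    [O(L ^ dim W)].

    On the other hand, write each [v_i] as [a_i + h w_i] with [a_i] in [V1].  The
    point above lies in [V1 + h X] whenever [s + \sum_i tau_i w_i] is in [X].  This
    gives a family of zeros parametrized by [X] and [c + 1] free parameters, of
    dimension [dim X + c + 1 > dim W].  A chain of irreducible sets of length [e] in
    [X] produces [L ^ e] independent functions of degree [O(L)] on [X]
    ([irreducible_chain_free]), and multiplying by powers of the [tau_i] gives
    [L ^ (e + c + 1)] independent functions of degree [O(L)] on the family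
    ([free_on_free_variables]), which is too many for large [L]
    ([growth_bound]). *)

(** * Linear spans and linear functionals *)

Section LinearSpan.
Variable k : fieldType.
Implicit Types V W : lmodType k.

(** The intersection form gives membership proofs by checking that a suitable
    subspace contains the generators. *)
Definition linear_span V (S : set V) : set V :=
  [set v | forall U : set V, subspace U -> (S `<=` U)%classic -> U v].

Lemma subspaceD V (U : set V) u v : subspace U -> U u -> U v -> U (u + v).
Proof. by move=> [_ sU] Uu Uv; rewrite -(scale1r u); apply: sU. Qed.

Lemma subspaceZ V (U : set V) a u : subspace U -> U u -> U (a *: u).
Proof. by move=> [U0 sU] Uu; rewrite -[_ *: _]addr0; apply: sU. Qed.

Lemma subspaceB V (U : set V) u v : subspace U -> U u -> U v -> U (u - v).
Proof.
by move=> sU Uu Uv; rewrite -scaleN1r; apply: subspaceD => //; apply: subspaceZ.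
Qed.

Lemma subspace_sum V (U : set V) (I : Type) (r : seq I) (P : pred I)
    (F : I -> V) :
  subspace U -> (forall i, P i -> U (F i)) -> U (\sum_(i <- r | P i) F i).
Proof.
move=> sU UF; apply: big_ind => //; first by case: sU.
by move=> x y; apply: subspaceD.
Qed.

Lemma subspace_linear_span V (S : set V) : subspace (linear_span S).
Proof.
split=> [U [U0 _] _ //|a u v Su Sv U sU SU].
by case: (sU) => _; apply; [apply: Su | apply: Sv].
Qed.

Lemma sub_linear_span V (S : set V) : (S `<=` linear_span S)%classic.
Proof. by move=> v Sv U _; apply. Qed.

Lemma linear_span_min V (S U : set V) :
  subspace U -> (S `<=` U)%classic -> (linear_span S `<=` U)%classic.
Proof. by move=> sU SU v; apply. Qed.

Lemma linear_spanS V (S T : set V) :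
  (S `<=` T)%classic -> (linear_span S `<=` linear_span T)%classic.
Proof.
move=> ST; apply: linear_span_min (subspace_linear_span _) _ => v Sv.
by apply: sub_linear_span; apply: ST.
Qed.

Lemma subspace_preimage V W (f : V -> W) (U : set W) :
  linear f -> subspace U -> subspace (f @^-1` U)%classic.
Proof.
move=> f_lin [U0 sU]; split=> [|a u v Uu Uv] /=.
  by have := f_lin (-1) 0 0; rewrite scaler0 addr0 scaleN1r addNr => ->.
by rewrite f_lin; apply: sU.
Qed.

Lemma linear_span_image V W (f : V -> W) (S : set V) (T : set W) :
    linear f -> (forall v, S v -> linear_span T (f v)) ->
  forall v, linear_span S v -> linear_span T (f v).
Proof.
move=> f_lin fS.
apply: (linear_span_min (U := (f @^-1` linear_span T)%classic)) => //.
exact: subspace_preimage (subspace_linear_span _).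
Qed.

Lemma linear_span_finite V (J : finType) (f : J -> V) (S : set V) v :
    (forall u, S u -> exists j, u = f j) -> linear_span S v ->
  exists a : J -> k, v = \sum_j a j *: f j.
Proof.
move=> Sf; move: v.
apply: (linear_span_min (U := [set v | exists a : J -> k, v = \sum_j a j *: f j]%classic)).
  split=> [|a _ _ [b ->] [c ->]].
    by exists (fun=> 0); rewrite big1 // => j _; rewrite scale0r.
  exists (fun j => a * b j + c j); rewrite scaler_sumr -big_split /=.
  by apply: eq_bigr => j _; rewrite scalerDl scalerA.
move=> _ /Sf [i ->]; exists (fun j => (j == i)%:R).
rewrite (bigD1 i) //= eqxx scale1r big1 ?addr0 // => j /negPf ->.
by rewrite scale0r.
Qed.

(** A subspace maximal among those that contain [U] and avoid [x] is a
    hyperplane, and the functional is the coordinate along [x] modulo it. *)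
Lemma exists_functional V (U : set V) (x : V) :
    subspace U -> ~ U x ->
  exists f : {scalar V}, (forall u, U u -> f u = 0) /\ f x = 1.
Proof.
move=> sU Ux.
(* The empty set is admitted only because it is the union of the empty chain. *)
pose admissible (M : set V) :=
  M = set0 \/ [/\ subspace M, (U `<=` M)%classic & ~ M x].
have [F adF totF|M0 [admM0 maxM0]] := @Zorn_bigcup V admissible.
  have [allF0|] := pselect (forall M, F M -> M = set0).
    by left; apply: bigcup0.
  move=> /existsNP [M /not_implyP [FM nM0]]; right.
  have ne N : F N -> (N !=set0)%classic -> [/\ subspace N, (U `<=` N)%classic & ~ N x].
    by move=> /adF [->|//]; case.
  have [sM UM Mx] := ne M FM (proj1 (set0P M) (introN eqP nM0)).
  split=> [|u Uu|[N FN Nx]]; last 2 first.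
  - by exists M => //; apply: UM.
  - by have [] := ne N FN (ex_intro _ x Nx).
  split=> [|a u v [N FN Nu] [N' FN' Nv]]; first by exists M => //; case: sM.
  have [sN _ _] := ne N FN (ex_intro _ u Nu).
  have [sN' _ _] := ne N' FN' (ex_intro _ v Nv).
  have [NN'|N'N] := totF N N' FN FN'; [exists N' | exists N] => //.
  + by case: sN' => _; apply=> //; apply: NN'.
  + by case: sN => _; apply=> //; apply: N'N.
have [M [sM UM Mx maxM]] : exists M : set V, [/\ subspace M, (U `<=` M)%classic,
    ~ M x & forall N, subspace N -> (M `<=` N)%classic -> ~ N x ->
      (N `<=` M)%classic].
  case: admM0 => [M00|[sM UM Mx]]; last first.
    exists M0; split=> // N sN MN Nx; apply: contrapT => nNM.
    by apply: (maxM0 N); [split | right; split=> // u /UM /MN].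
  have adU : admissible U by right; split.
  case: (maxM0 U) => //; rewrite M00; split=> [//|U_empty].
  by have : (set0 : set V) 0 by apply: U_empty; case: sU.
(* Otherwise [M + k v] avoids [x], against maximality of [M]. *)
have decomp v : exists t, M (v - t *: x).
  apply: contrapT => nt.
  pose N := [set u | exists t, M (u - t *: v)]%classic.
  have sN : subspace N.
    split=> [|a u u' [t Mt] [t' Mt']].
      by exists 0; rewrite scale0r subr0; case: sM.
    exists (a * t + t'); rewrite scalerDl opprD addrACA -scalerA -scalerBr.
    by case: sM => _; apply.
  have MN : (M `<=` N)%classic by move=> u Mu; exists 0; rewrite scale0r subr0.
  have [[t Mt]|Nx] := pselect (N x).
    have [t0|t_neq0] := eqVneq t 0; first by rewrite t0 scale0r subr0 in Mt.
    apply: nt; exists t^-1.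
    have -> : v - t^-1 *: x = - t^-1 *: (x - t *: v).
      by rewrite scalerBr scalerA mulNr mulVf // scaleN1r opprK scaleNr addrC.
    exact: subspaceZ.
  apply: nt; exists 0; rewrite scale0r subr0.
  apply: (maxM N) => //; exists 1; rewrite scale1r subrr; by case: sM.
have [f fP] := choice decomp.
have uniq_t v t : M (v - t *: x) -> t = f v.
  move=> Mt; apply/eqP; rewrite -subr_eq0; apply: contraT => ne0; case: Mx.
  rewrite -[x]scale1r -(mulVf ne0) -scalerA; apply: subspaceZ => //.
  have -> : (t - f v) *: x = (v - f v *: x) - (v - t *: x).
    by rewrite opprB [RHS]addrC addrA subrK -scalerBl.
  exact: subspaceB.
have f_lin : scalar f.
  move=> a u v; apply/esym/uniq_t.
  rewrite scalerDl opprD addrACA -scalerA -scalerBr.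
  by case: sM => _; apply.
pose f_mixin := GRing.isLinear.Build k V k *%R f f_lin.
pose F : {scalar V} := HB.pack f f_mixin.
exists F; split=> [u Uu|] /=; apply/esym/uniq_t.
  by rewrite scale0r subr0; apply: UM.
by rewrite scale1r subrr; case: sM.
Qed.

End LinearSpan.

(** * Standard sums *)

Section StandardSum.
Variables (R : pzRingType) (T : finType).

Definition standard_sum (x : T -> R) : R :=
  \sum_(s : {perm T}) (-1) ^+ s * \prod_(t : T) x (s t).

(** Pairing [s] with [s * tperm a b] cancels the sum; only the values of [x] are
    permuted, so the order of the factors is respected. *)
Lemma standard_sum_alternate (x : T -> R) a b :
  a != b -> x a = x b -> standard_sum x = 0.
Proof.
move=> ab xab; pose tau := tperm a b.
have odd_tau s : (s * tau)%g = ~~ s :> bool.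
  by rewrite odd_permM odd_tperm ab addbT.
rewrite /standard_sum (bigID (@odd_perm _)) /=.
apply: canLR (subrK _) _; rewrite add0r -sumrN.
rewrite (reindex_inj (mulIg tau)); apply: eq_big => //= s.
rewrite odd_tau => /negPf ->; rewrite mulN1r mul1r; congr (- _).
apply: eq_bigr => t _; rewrite permM /tau.
by case: tpermP => // ->; rewrite xab.
Qed.

(** Linearity in one factor, isolated by splitting the product around the only
    index where that factor occurs. *)
Lemma prod_update (r : seq T) (t0 : T) (g : T -> R) :
    uniq r -> t0 \in r ->
  exists A B, forall y,
    \prod_(t <- r) (if t == t0 then y else g t) = A * y * B.
Proof.
move=> + r_t0; case/splitPr: r_t0 => r1 r2.
rewrite cat_uniq /= negb_or => /and3P [_ /andP [t0r1 _] /andP [t0r2 _]].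
exists (\prod_(t <- r1) g t), (\prod_(t <- r2) g t) => y.
rewrite big_cat big_cons eqxx /= -mulrA; congr (_ * (_ * _)).
  by rewrite 2!big_seq; apply: eq_bigr => t; case: eqP => // -> /(negP t0r1).
by rewrite 2!big_seq; apply: eq_bigr => t; case: eqP => // -> /(negP t0r2).
Qed.

End StandardSum.

(** The standard sum is linear in each argument and alternating, so it vanishes
    on linearly dependent families. *)
Lemma standard_sum_dependent (k : fieldType) (R : algType k) (T : finType)
    (x : T -> R) (t0 : T) :
    linear_span [set y | exists2 t, t != t0 & y = x t]%classic (x t0) ->
  standard_sum x = 0.
Proof.
pose upd y t := if t == t0 then y else x t.
move=> /(linear_span_min (U := [set y | standard_sum (upd y) = 0]%classic)) /=.
have -> : upd (x t0) = x.
  by apply/funext => t; rewrite /upd; case: eqP => [->|].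
apply => [|_ [t tt0 ->]] /=; last first.
  by apply: (@standard_sum_alternate _ _ _ t t0) => //; rewrite /upd eqxx (negPf tt0).
have pos (s : {perm T}) : exists A B, forall y, \prod_t upd y (s t) = A * y * B.
  have [A [B AB]] := prod_update (fun t => x (s t)) (index_enum_uniq T)
    (mem_index_enum ((s^-1)%g t0)).
  exists A, B => y; rewrite -AB; apply: eq_bigr => t _.
  by rewrite /upd (canF_eq (permK s)).
split=> [|a u v].
  rewrite /= /standard_sum big1 // => s _.
  by have [A [B ->]] := pos s; rewrite mulr0 mul0r mulr0.
rewrite /= => u0 v0.
transitivity (a *: standard_sum (upd u) + standard_sum (upd v)).
  rewrite scaler_sumr -big_split; apply: eq_bigr => s _ /=.
  have [A [B AB]] := pos s; rewrite !AB mulrDr mulrDl mulrDr.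
  by rewrite -[A * (a *: u)]scalerAr -scalerAl -scalerAr.
by rewrite u0 v0 scaler0 addr0.
Qed.

(** * The standard polynomial of all words of a given length *)

Section WordsStandard.
Variables (k : fieldType) (d m : nat).

Definition concat_words (s : {perm d.-tuple 'I_m}) : {fmonom 'I_m} :=
  FMonom (flatten [seq tval (s t) | t <- index_enum {: d.-tuple 'I_m}]).

(** The standard polynomial evaluated at all words of length [d]. *)
Definition words_standard : ncpoly k m :=
  \sum_(s : {perm d.-tuple 'I_m}) << (-1) ^+ s *g concat_words s >>.

(** All the words have the same length, so their concatenation can be cut back
    into its factors. *)
Lemma concat_words_inj : injective concat_words.
Proof.
move=> s s' [eq_ss']; pose e := index_enum {: d.-tuple 'I_m}.
have shapeE (u : {perm d.-tuple 'I_m}) :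
    shape [seq tval (u t) | t <- e] = nseq (size e) d.
  by elim: e => //= t e' ->; rewrite size_tuple.
have /eq_in_map eqs : [seq tval (s t) | t <- e] = [seq tval (s' t) | t <- e].
  by rewrite -[LHS]flattenK -[RHS]flattenK !shapeE -/e eq_ss'.
by apply/permP => t; apply/val_inj/eqs; apply: mem_index_enum.
Qed.

Lemma words_standard_neq0 : words_standard <> 0.
Proof.
move=> /(congr1 (mcoeff (concat_words 1))); rewrite mcoeff0 raddf_sum /=.
rewrite (bigD1 1%g) //= big1 => [|s s1].
  by rewrite mcoeffU eqxx odd_perm1 addr0 => /eqP; rewrite oner_eq0.
by rewrite mcoeffU (inj_eq concat_words_inj) (negPf s1).
Qed.

Lemma nc_eval_words_standard (R : algType k) (r : 'I_m -> R) :
  nc_eval words_standard r =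
    standard_sum (fun t : d.-tuple 'I_m => \prod_(i <- t) r i).
Proof.
rewrite /nc_eval /words_standard raddf_sum /=; apply: eq_bigr => s _.
rewrite mmapU; congr (_ * _); last first.
  by rewrite /concat_words /= big_flatten big_map.
by rewrite -[LHS]/(in_alg R _) rmorph_sign.
Qed.

End WordsStandard.

(** * Function spaces spanned by monomials *)

Section MonomialSpan.
Variables (k : fieldType) (Y : Type).

Lemma mulfr_linear (g : Y -> k^o) : linear (fun f : Y -> k^o => f * g).
Proof.
by move=> a f f'; apply/funext => y; rewrite !fctE mulrDl scalerAl.
Qed.

Lemma mulrf_linear (g : Y -> k^o) : linear (fun f : Y -> k^o => g * f).
Proof. by move=> a f f'; rewrite ![g * _]mulrC mulfr_linear. Qed.

Variables (I : finType) (x : I -> Y -> k^o).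

Definition mon (q : seq I) : Y -> k^o := \prod_(i <- q) x i.

Definition degree_span (L : nat) : set (Y -> k^o) :=
  linear_span [set f | exists2 q : seq I, (size q <= L)%N & f = mon q]%classic.

Lemma mon_cat q q' : mon (q ++ q') = mon q * mon q'.
Proof. exact: big_cat. Qed.

Lemma mon_nseq c i : mon (nseq c i) = x i ^+ c.
Proof. by rewrite /mon big_nseq iter_mulr_1. Qed.

Lemma mon_count q : mon q = \prod_i x i ^+ count_mem i q.
Proof.
elim: q => [|j q IHq]; first by rewrite /mon big_nil big1.
rewrite /mon big_cons -/(mon q) IHq (bigD1 j) //= [RHS](bigD1 j) //= eqxx exprS.
rewrite mulrA; congr (_ * _); apply: eq_bigr => i /negPf.
by rewrite eq_sym => ->.
Qed.

Lemma degree_span_mon L q : (size q <= L)%N -> degree_span L (mon q).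
Proof. by move=> qL; apply: sub_linear_span; exists q. Qed.

Lemma degree_spanS L L' f : (L <= L')%N -> degree_span L f -> degree_span L' f.
Proof.
move=> LL'; apply: linear_spanS => _ [q qL ->]; exists q => //.
exact: leq_trans LL'.
Qed.

Lemma degree_span_cst L (a : k) : degree_span L (fun=> a).
Proof.
have -> : (fun=> a) = a *: mon [::].
  by apply/funext => y; rewrite /mon big_nil !fctE -[RHS]/(a * 1) mulr1.
by apply: subspaceZ (subspace_linear_span _) _; apply: degree_span_mon.
Qed.

Lemma degree_spanX i : degree_span 1 (x i).
Proof. by have := @degree_span_mon 1 [:: i] isT; rewrite /mon big_seq1. Qed.

Lemma degree_spanM L L' f g :
  degree_span L f -> degree_span L' g -> degree_span (L + L') (f * g).
Proof.
move=> Lf L'g; move: f Lf; apply: (linear_span_image (mulfr_linear g)).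
move=> _ [q qL ->]; move: g L'g; apply: (linear_span_image (mulrf_linear _)).
move=> _ [q' q'L ->]; rewrite -mon_cat; apply: degree_span_mon.
by rewrite size_cat leq_add.
Qed.

Lemma degree_span_exp L f c : degree_span L f -> degree_span (c * L) (f ^+ c).
Proof.
move=> Lf; elim: c => [|c IHc]; first exact: degree_span_cst.
by rewrite exprS mulSn; apply: degree_spanM.
Qed.

End MonomialSpan.

(** Transfers degree bounds from [W] to a family parametrized by other coordinates
    in which those of [W] have degree one. *)
Lemma degree_span_comp (k : fieldType) (Y Y' : Type) (I I' : finType)
    (x : I -> Y -> k^o) (x' : I' -> Y' -> k^o) (phi : Y' -> Y) :
    (forall i, degree_span x' 1 (x i \o phi)) ->
  forall L f, degree_span x L f -> degree_span x' L (f \o phi).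
Proof.
move=> x_phi L; apply: linear_span_image => [//|_ [q qL ->]].
apply: (degree_spanS qL); elim: q {qL} => [|i q IHq].
  have -> : mon x [::] \o phi = fun=> 1 by rewrite /mon big_nil.
  exact: degree_span_cst.
have -> : mon x (i :: q) \o phi = (x i \o phi) * (mon x q \o phi).
  by rewrite /mon big_cons.
by rewrite /= -add1n; apply: degree_spanM.
Qed.

(** * Linearly independent functions *)

Section FreeOn.
Variables (k : fieldType) (Y : Type).

Definition free_on (Z : set Y) (J : finType) (phi : J -> Y -> k^o) :=
  forall a : J -> k, (forall y, Z y -> \sum_j a j * phi j y = 0) ->
    forall j, a j = 0.

(** With more functions [phi] than generators [g], the matrix of coefficients has
    a nonzero vector in its left kernel, that is, a relation. *)
Lemma free_on_card (J J' : finType) (phi : J -> Y -> k^o) (g : J' -> Y -> k^o)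
    (S : set (Y -> k^o)) :
    (forall f, S f -> exists j', f = g j') ->
    (forall j, linear_span S (phi j)) -> free_on setT phi ->
  (#|J| <= #|J'|)%N.
Proof.
move=> Sg Sphi free_phi.
have /choice [A phiE] j := linear_span_finite Sg (Sphi j).
rewrite leqNgt; apply/negP => ltJ.
pose M : 'M[k]_(#|J|, #|J'|) := \matrix_(i, i') A (enum_val i) (enum_val i').
have ker_neq0 : kermx M != 0.
  rewrite kermx_eq0 /row_free; apply: contraTneq ltJ => <-.
  by rewrite -leqNgt rank_leq_col.
have [u uM u_neq0] : exists2 u : 'rV_#|J|, u *m M = 0 & u != 0.
  exists (nz_row (kermx M)); last by rewrite nz_row_eq0.
  by apply/sub_kermxP; apply: nz_row_sub.
case/eqP: u_neq0; apply/rowP => i; rewrite mxE.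
have := free_phi (fun j => u 0 (enum_rank j)).
move=> /(_ _ (enum_val i)); rewrite enum_valK; apply=> y _.
transitivity (\sum_j' (\sum_j u 0 (enum_rank j) * A j j') * g j' y).
  under [RHS]eq_bigr => j' _ do rewrite mulr_suml.
  rewrite exchange_big; apply: eq_bigr => j _; rewrite phiE fct_sumE mulr_sumr.
  by apply: eq_bigr => j' _; rewrite fctE mulrA.
apply: big1 => j' _; rewrite [X in X * _](_ : _ = (u *m M) 0 (enum_rank j')).
  by rewrite uM mxE mul0r.
rewrite mxE (reindex _ (onW_bij _ (@enum_val_bij J))) /=.
by apply: eq_bigr => i' _; rewrite mxE enum_valK enum_rankK.
Qed.

End FreeOn.

(** * Reducing exponents *)

Section Reduction.
Variables (k : fieldType) (Y : Type) (N p d : nat).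
Variable x : 'I_N + 'I_p -> Y -> k^o.

Definition is_inr (A B : Type) (z : A + B) := if z is inr _ then true else false.

(** Bounding the degree in the second group of variables strictly, and the total
    degree only weakly, is what makes the rewriting of [x (inr i) ^+ d] terminate
    without leaving the space of functions of given degree. *)
Definition low_monomials : set (Y -> k^o) :=
  [set f | exists q, [/\ (size q <= d)%N, (count (@is_inr _ _) q < d)%N
    & f = mon x q]]%classic.

Definition reduced_monomials (L : nat) : set (Y -> k^o) :=
  [set f | exists q, [/\ (size q <= L)%N,
    forall i : 'I_p, (count_mem (inr i) q < d)%N & f = mon x q]]%classic.

(** Substituting the relation for a factor [x (inr i) ^+ d] does not increase the
    total degree and decreases the degree in the second group of variables. *)
Lemma degree_span_reduce L f :
    (forall i : 'I_p, linear_span low_monomials (x (inr i) ^+ d)) ->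
  degree_span x L f -> linear_span (reduced_monomials L) f.
Proof.
move=> rel; move: f; apply: linear_span_min (subspace_linear_span _) _.
move=> _ [q qL ->]; have [n] := ubnP (count (@is_inr _ _) q).
elim: n q qL => // n IHn q qL; rewrite ltnS => qn.
have [/forallP red|] := boolP [forall i : 'I_p, count_mem (inr i) q < d]%N.
  by apply: sub_linear_span; exists q.
rewrite negb_forall => /existsP [i]; rewrite -leqNgt => di.
pose z : 'I_N + 'I_p := inr i.
pose q' := nseq (count_mem z q - d) z ++ [seq j <- q | j != z].
have qq' : perm_eq q (nseq d z ++ q').
  rewrite /q' catA -nseqD subnKC //.
  rewrite -(perm_filterC (pred1 z) q) perm_cat2r.
  have /all_pred1P -> := filter_all (pred1 z) q.
  by rewrite size_filter perm_refl.
have -> : mon x q = x z ^+ d * mon x q'.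
  by rewrite -mon_nseq -mon_cat /mon (perm_big _ qq').
have size_q : size q = (d + size q')%N.
  by rewrite (perm_size qq') size_cat size_nseq.
have count_q : count (@is_inr _ _) q = (d + count (@is_inr _ _) q')%N.
  by rewrite (seq.permP qq') count_cat count_nseq /= mul1n.
move: (x z ^+ d) (rel i); apply: (linear_span_image (mulfr_linear _)).
move=> _ [r [rd cr ->]]; rewrite -mon_cat; apply: IHn.
  by rewrite size_cat; apply: leq_trans qL; rewrite size_q leq_add2r.
rewrite count_cat; apply: leq_trans qn.
by rewrite count_q ltn_add2r.
Qed.

(** The bound is polynomial in [L] of degree [N] only: the second group of
    variables contributes the constant factor [d ^ p]. *)
Lemma free_on_card_reduced L (J : finType) (phi : J -> Y -> k^o) :
    (forall i : 'I_p, linear_span low_monomials (x (inr i) ^+ d)) ->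
    (forall j, degree_span x L (phi j)) -> free_on setT phi ->
  (#|J| <= L.+1 ^ N * d ^ p)%N.
Proof.
move=> rel Lphi free_phi.
pose J' := ({ffun 'I_N -> 'I_L.+1} * {ffun 'I_p -> 'I_d})%type.
have -> : (L.+1 ^ N * d ^ p)%N = #|{: J'}|.
  by rewrite card_prod !card_ffun !card_ord.
pose g (b : J') := (\prod_j x (inl j) ^+ b.1 j) * (\prod_i x (inr i) ^+ b.2 i).
apply: (@free_on_card _ _ _ _ phi g (reduced_monomials L)) => //; last first.
  by move=> j; apply: degree_span_reduce.
move=> _ [q [qL redq ->]].
exists ([ffun j => inord (count_mem (inl j) q)], [ffun i => Ordinal (redq i)]).
rewrite mon_count big_sumType /g /=; congr (_ * _); apply: eq_bigr => i _.
  by rewrite ffunE inordK // ltnS (leq_trans (count_size _ _)).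
by rewrite ffunE.
Qed.

End Reduction.

(** * Irreducible sets and chains *)

Section PolynomialFunctions.
Variables (k : fieldType) (V : lmodType k).
Implicit Types (f g : V -> k) (Z : set V).

Lemma polyfun_sum (I : Type) (r : seq I) (F : I -> V -> k) :
  (forall i, polyfun (F i)) -> polyfun (fun v => \sum_(i <- r) F i v).
Proof.
move=> pF; elim: r => [|i r IHr].
  by under eq_fun do rewrite big_nil; apply: polyfun_cst.
by under eq_fun do rewrite big_cons; apply: polyfun_add.
Qed.

Lemma polyfun_exp f c : polyfun f -> polyfun (fun v => f v ^+ c).
Proof.
move=> pf; elim: c => [|c IHc].
  by under eq_fun do rewrite expr0; apply: polyfun_cst.
by under eq_fun do rewrite exprS; apply: polyfun_mul.
Qed.

(** The ideal of all polynomial functions that vanish on the intersection cuts it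
    out, so no description of its generators is needed. *)
Lemma algebraic_set_cut Z f : algebraic_set Z -> polyfun f ->
  algebraic_set [set v | Z v /\ f v = 0]%classic.
Proof.
move=> [I [I_poly I0 ID IM] ZE] pf; set Y := [set v | _]%classic.
exists [set g | polyfun g /\ forall v, Y v -> g v = 0]%classic.
  split=> [g []//||g h [pg g0] [ph h0]|g h pg [ph h0]].
  - by split=> //; apply: polyfun_cst.
  - split=> [|v Yv]; first exact: polyfun_add.
    by rewrite g0 // h0 // addr0.
  - split=> [|v Yv]; first exact: polyfun_mul.
    by rewrite h0 // mulr0.
apply/seteqP; split=> [v Yv g [_]|v]; first exact.
move=> Yv; split; last by apply: Yv; split=> // w [].
rewrite ZE => g Ig; apply: Yv; split; first exact: I_poly.
by move=> w [+ _]; rewrite ZE; apply.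
Qed.

Lemma irreducible_set_integral Z f g :
    irreducible_set Z -> polyfun f -> polyfun g ->
    (forall v, Z v -> f v * g v = 0) ->
  (forall v, Z v -> f v = 0) \/ (forall v, Z v -> g v = 0).
Proof.
move=> [algZ _ irrZ] pf pg fg0.
have := irrZ _ _ (algebraic_set_cut algZ pf) (algebraic_set_cut algZ pg).
case=> [|Zf|Zg].
- apply/seteqP; split=> [v Zv|v [] []//].
  by have /eqP := fg0 v Zv; rewrite mulf_eq0 => /orP [] /eqP; [left | right].
- by left=> v; rewrite {1}Zf => -[].
- by right=> v; rewrite {1}Zg => -[].
Qed.

(** The lowest power of [g] can be cancelled from a relation on [Z]; on [Z'] only
    its coefficient survives. *)
Lemma free_on_irreducible Z Z' (J : finType) (phi : J -> V -> k) g L :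
    irreducible_set Z -> (Z' `<=` Z)%classic ->
    (forall j, polyfun (phi j)) -> free_on Z' phi ->
    polyfun g -> (forall v, Z' v -> g v = 0) ->
    (exists2 v, Z v & g v <> 0) ->
  free_on Z (fun (jl : J * 'I_L) v => phi jl.1 v * g v ^+ jl.2).
Proof.
move=> irrZ Z'Z pphi free_phi pg g0 [v0 Zv0 gv0] a rel.
(* The coefficients of [g ^+ l] are killed in increasing order of [l]. *)
suff coef0 n (jl : J * 'I_L) : (jl.2 < n)%N -> a jl = 0 by move=> jl; apply: (coef0 jl.2.+1).
elim: n jl => // n IHn [j l] /=; rewrite ltnS leq_eqVlt => /predU1P [ln|]; last first.
  by move=> ln; apply: IHn.
(* [h] is the relation divided by [g ^+ n]; the truncation of [l - n] is harmless,
   since the terms with [l < n] have coefficient zero. *)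
pose h v := \sum_(jl : J * 'I_L) a jl * (phi jl.1 v * g v ^+ (jl.2 - n)).
have ph : polyfun h.
  apply: polyfun_sum => jl; apply: polyfun_mul; first exact: polyfun_cst.
  by apply: polyfun_mul => //; apply: polyfun_exp.
have gh0 v : Z v -> g v ^+ n * h v = 0.
  move=> Zv; rewrite -(rel v Zv) mulr_sumr; apply: eq_bigr => jl _.
  have [jln|njl] := ltnP jl.2 n; first by rewrite IHn // !mul0r mulr0.
  by rewrite mulrCA [g v ^+ n * _]mulrCA -exprD subnKC.
have [gn0|h0] := irreducible_set_integral irrZ (polyfun_exp n pg) ph gh0.
  by have /eqP := gn0 v0 Zv0; rewrite expf_eq0 => /andP [_ /eqP].
apply: (free_phi (fun j => a (j, l))) => v Z'v; rewrite -[RHS](h0 v (Z'Z v Z'v)).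
transitivity (\sum_j \sum_(l' < L) a (j, l') * (phi j v * g v ^+ (l' - n))); last first.
  by rewrite pair_bigA; apply: eq_bigr => -[].
apply: eq_bigr => i _; rewrite (bigD1 l) //= ln subnn expr0 mulr1.
rewrite big1 ?addr0 // => l' l'l; have [l'n|nl'] := ltnP l' n.
  by rewrite IHn ?mul0r.
rewrite g0 // expr0n subn_eq0 leqNgt ltn_neqAle nl' andbT -ln.
by rewrite eq_sym (inj_eq val_inj) l'l !mulr0.
Qed.

End PolynomialFunctions.

Lemma free_onS (k : fieldType) (Y : Type) (Z X : set Y) (J : finType)
    (phi : J -> Y -> k) :
  (Z `<=` X)%classic -> free_on Z phi -> free_on X phi.
Proof. by move=> ZX free_phi a rel; apply: free_phi => y /ZX; apply: rel. Qed.

Section Coordinates.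
Variables (k : fieldType) (W : vectType k).

Definition vcoord (j : 'I_(\dim {:W})) (w : W) : k^o := coord (vbasis {:W}) j w.

Lemma vcoord_sum w : w = \sum_j vcoord j w *: (vbasis {:W})`_j.
Proof. exact: coord_vbasis (memvf w). Qed.

Lemma degree_span_linear (f : {scalar W}) : degree_span vcoord 1 f.
Proof.
have -> : (f : W -> k^o) = \sum_(j < \dim {:W}) f (vbasis {:W})`_j *: vcoord j.
  apply/funext => w; rewrite {1}(vcoord_sum w) linear_sum fct_sumE.
  by apply: eq_bigr => j _; rewrite linearZ /= mulrC.
apply: subspace_sum (subspace_linear_span _) _ => j _.
by apply: subspaceZ (subspace_linear_span _) _; apply: degree_spanX.
Qed.

Lemma polyfun_degree_span (f : W -> k) :
  polyfun f -> exists D, degree_span vcoord D f.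
Proof.
elim=> [a|g|g h _ [D Dg] _ [E Eh]|g h _ [D Dg] _ [E Eh]].
- by exists 0; apply: degree_span_cst.
- by exists 1; apply: degree_span_linear.
- exists (maxn D E); rewrite -[X in degree_span _ _ X]/((g : W -> k^o) + h).
  apply: subspaceD (subspace_linear_span _) _ _.
    by apply: degree_spanS Dg; apply: leq_maxl.
  by apply: degree_spanS Eh; apply: leq_maxr.
- by exists (D + E)%N; apply: (@degree_spanM _ _ _ _ _ _ g h).
Qed.

(** Choosing [g] that vanishes on one member of the chain but not on the next, the
    powers of [g] multiply the number of independent functions by [L] while the
    degree grows linearly in [L]. *)
Lemma irreducible_chain_free (X : set W) e : irreducible_chain X e ->
  exists D, forall L, exists (J : finType) (phi : J -> W -> k),
    [/\ #|J| = (L ^ e)%N, forall j, degree_span vcoord (D * L) (phi j)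
      & free_on X phi].
Proof.
move=> [Z [irrZ ltZ]].
suff [D HD] : exists D, forall L, exists (J : finType) (phi : J -> W -> k),
    [/\ #|J| = (L ^ e)%N, forall j, polyfun (phi j),
      forall j, degree_span vcoord (D * L) (phi j) & free_on (Z e) phi].
  exists D => L; have [J [phi [cardJ _ Dphi free_phi]]] := HD L.
  exists J, phi; split=> //; apply: free_onS free_phi.
  exact: (proj2 (irrZ e (leqnn e))).
elim: {-2}e (leqnn e) => [_|i IHi ie].
  exists 0 => L; exists unit, (fun _ _ => 1); split=> [|_|_|a rel j].
  - by rewrite card_unit.
  - exact: polyfun_cst.
  - exact: degree_span_cst.
  have [[_ [z Zz] _] _] := irrZ 0 (leq0n e).
  by have := rel z Zz; rewrite (bigD1 j) //= big1 ?mulr1 ?addr0 //; case=> //; case: j.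
have [D HD] := IHi (ltnW ie).
have [irrZi _] := irrZ i (ltnW ie); have [irrZi1 _] := irrZ i.+1 ie.
have [Z_sub Z_nsub] := ltZ i ie.
have [g pg [g0 g_neq0]] : exists2 g, polyfun g &
    (forall v, Z i v -> g v = 0) /\ (exists2 v, Z i.+1 v & g v <> 0).
  have [[I [I_poly _ _ _] ZE] _ _] := irrZi.
  apply: contrapT => no_g; apply: Z_nsub => v Zv; rewrite ZE => g Ig.
  apply: contrapT => gv; apply: no_g; exists g; first exact: I_poly.
  by split; [move=> w; rewrite ZE; apply | exists v].
have [Dg g_deg] := polyfun_degree_span pg.
exists (D + Dg)%N => L; have [J [phi [cardJ pphi Dphi free_phi]]] := HD L.
exists (J * 'I_L)%type, (fun (jl : J * 'I_L) v => phi jl.1 v * g v ^+ jl.2); split.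
- by rewrite card_prod card_ord cardJ expnSr.
- by move=> jl; apply: polyfun_mul => //; apply: polyfun_exp.
- move=> jl; have -> : (fun v => phi jl.1 v * g v ^+ jl.2) =
      (phi jl.1 : W -> k^o) * (g : W -> k^o) ^+ jl.2.
    by apply/funext => v; rewrite !fctE.
  apply: (@degree_spanS _ _ _ _ (D * L + jl.2 * Dg)).
    by rewrite mulnDl leq_add2l mulnC leq_mul2l (ltnW (ltn_ord _)) orbT.
  by apply: degree_spanM; [apply: Dphi | apply: degree_span_exp].
- exact: (@free_on_irreducible _ _ (Z i.+1) (Z i) J phi g L).
Qed.

End Coordinates.

(** Multiplying by the powers of [p] new free variables keeps independence,
    because a polynomial that vanishes on an infinite field is zero. *)
Lemma free_on_free_variables (k : closedFieldType) (Y : Type) (Z : set Y)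
    (J : finType) (phi : J -> Y -> k) (L p : nat) : free_on Z phi ->
  exists (J' : finType) (b : J' -> J) (c : J' -> nat -> nat),
    [/\ #|J'| = (#|J| * L ^ p)%N, forall j i, (c j i <= L)%N
      & free_on [set y : Y * (nat -> k) | Z y.1]%classic
          (fun j y => phi (b j) y.1 * \prod_(i < p) y.2 i ^+ c j i)].
Proof.
move=> free_phi; elim: p => [|p [J' [b [c [cardJ' cL free_J']]]]].
  exists J, id, (fun _ _ => 0); split=> // [|a rel]; first by rewrite muln1.
  apply: free_phi => y Zy; rewrite -[RHS](rel (y, fun=> 0) Zy).
  by apply: eq_bigr => j _; rewrite big_ord0 mulr1.
exists (J' * 'I_L)%type, (fun jl : J' * 'I_L => b jl.1),
  (fun (jl : J' * 'I_L) i => if i == p then jl.2 : nat else c jl.1 i).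
split=> [|[j l] i /=|a rel [j l]].
- by rewrite card_prod card_ord cardJ' expnSr mulnA.
- by case: ifP => // _; apply: ltnW.
apply: (free_J' (fun j => a (j, l))) => y Zy.
pose psi j := phi (b j) y.1 * \prod_(i < p) y.2 i ^+ c j i.
(* Varying the last coordinate of [y] alone, the relation becomes a polynomial
   in it, whose coefficients are relations among the previous functions. *)
pose P := \poly_(l' < L) (if insub l' is Some l then \sum_j a (j, l) * psi j else 0).
suff : P = 0.
  by move=> /(congr1 (fun q : {poly k} => q`_l)); rewrite coef_poly ltn_ord valK coef0.
apply/eqP; apply: contraT => /closed_nonrootP [t]; case/negP.
apply/rootP; rewrite horner_poly.
rewrite -[RHS](rel (y.1, fun i => if i == p then t else y.2 i) Zy).
transitivity (\sum_j' \sum_(l' < L) a (j', l') * (psi j' * t ^+ l')).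
  rewrite exchange_big; apply: eq_bigr => l' _; rewrite valK mulr_suml.
  by apply: eq_bigr => j' _; rewrite -mulrA.
rewrite pair_bigA; apply: eq_bigr => -[j' l'] _ /=.
rewrite /psi -mulrA big_ord_recr /= eqxx; congr (_ * (_ * (_ * _))).
by apply: eq_bigr => i _; rewrite ltn_eqF.
Qed.

(** * The relations imposed by a polynomial with many zeros *)

Lemma prod_sum_scale (k : fieldType) (R : algType k) (n : nat) (I : finType)
    (c : I -> k) (u : I -> 'I_n -> R) (w : seq 'I_n) :
  \prod_(l <- w) (\sum_i c i *: u i l) =
    \sum_(q : {ffun 'I_(size w) -> I})
      (\prod_j c (q j)) *: \prod_j u (q j) (tnth (in_tuple w) j).
Proof.
rewrite big_tnth bigA_distr_bigA; apply: eq_bigr => q _.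
by rewrite scaler_prod.
Qed.

Lemma has_degree_witness (k : fieldType) (n d : nat) (Q : ncpoly k n) :
    has_degree Q d ->
  (forall w, w \in msupp Q -> (size w <= d)%N) /\
  (exists2 w : {fmonom 'I_n}, w \in msupp Q & size w = d).
Proof.
move=> degQ; have leQ (w : {fmonom 'I_n}) : w \in msupp Q -> (size w <= d)%N.
  by move=> /(mmeasure_mnm_lt (@fdeg 'I_n)); rewrite degQ ltnS.
split=> //; apply: contrapT => nw.
suff : (mmeasure (@fdeg 'I_n) Q <= d)%N by rewrite degQ ltnn.
rewrite mmeasureE big_seq; apply: (big_ind (fun m => m <= d)%N) => // [m m'|w wQ].
  by rewrite geq_max => -> ->.
rewrite ltn_neqAle leQ // andbT; apply/eqP => wd.
by apply: nw; exists w.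
Qed.

Section Relation.
Variables (k : fieldType) (n d N p : nat) (R : algType k) (Y : Type).
Variables (x : 'I_N + 'I_p -> Y -> k^o) (u : 'I_N + 'I_p -> 'I_n -> R).

Definition letters : 'I_#|{: 'I_p * 'I_n}| -> R :=
  fun a => u (inr (enum_val a).1) (enum_val a).2.

(** A functional that isolates one word of top degree in the letters turns the
    vanishing of [Q] into a relation for the corresponding power. *)
Lemma power_in_low_monomials (Q : ncpoly k n) :
    has_degree Q d ->
    (forall y, nc_eval Q (fun l => \sum_z x z y *: u z l) = 0) ->
    (forall t : d.-tuple 'I_#|{: 'I_p * 'I_n}|,
       ~ linear_span [set a | exists2 t' : d.-tuple 'I_#|{: 'I_p * 'I_n}|,
           t' != t & a = \prod_(b <- t') letters b]%classic
         (\prod_(b <- t) letters b)) ->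
  forall i, linear_span (low_monomials d x) (x (inr i) ^+ d).
Proof.
move=> degQ Qx0 free_words i.
have [leQ [w0 w0Q w0d]] := has_degree_witness degQ.
have t0P : size [seq enum_rank (i, l) | l <- w0] == d by rewrite size_map w0d.
(* [t0] spells [w0] with all letters taken from the [i]-th vector. *)
pose t0 := Tuple t0P.
have [f [f0 f1]] := exists_functional (subspace_linear_span _) (free_words t0).
have {}f0 (s : seq 'I_#|{: 'I_p * 'I_n}|) :
    size s = d -> s <> t0 -> f (\prod_(b <- s) letters b) = 0.
  move=> /eqP sd s_t0; apply: f0; apply: sub_linear_span; exists (Tuple sd) => //.
  by apply/eqP => /(congr1 val).
pose coef (w : seq 'I_n) (q : {ffun 'I_(size w) -> 'I_N + 'I_p}) :=
  f (\prod_j u (q j) (tnth (in_tuple w) j)).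
pose term w q : Y -> k^o := @coef w q *: mon x [seq q j | j <- enum 'I_(size w)].
pose F w : Y -> k^o := \sum_q @term w q.
have Q0 : \sum_(w <- msupp Q) Q@_w *: F w = 0.
  apply/funext => y; rewrite -[RHS](linear0 f) -(Qx0 y) /nc_eval mmapE.
  rewrite fct_sumE linear_sum; apply: eq_bigr => w _.
  rewrite /= mulr_algl linearZ /= fctE; congr (_ * _).
  rewrite /F prod_sum_scale fct_sumE linear_sum; apply: eq_bigr => q _.
  rewrite linearZ /= /term /mon fct_prodE !fctE big_map big_enum.
  exact: mulrC.
pose S := linear_span (low_monomials d x).
have sS : subspace S := subspace_linear_span _.
(* A term with at least [d] variables of the second group is a word of length
   [d] in the letters, which [f] kills unless it is [t0]. *)
have termS (w : {fmonom 'I_n}) q : w \in msupp Q ->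
    S (@term w q) \/ w = w0 /\ q = [ffun=> inr i].
  move=> /leQ wd; set e := enum 'I_(size w).
  have size_e : size e = size w by rewrite /e size_enum_ord.
  have [low|] := ltnP (count (@is_inr _ _) [seq q j | j <- e]) d.
    left; apply: (@subspaceZ _ _ S _ _ sS); apply: sub_linear_span.
    by exists [seq q j | j <- e]; split=> //; rewrite size_map size_e.
  rewrite count_map => high.
  have {}wd : size w = d.
    apply/eqP; rewrite eqn_leq wd -size_e; exact: leq_trans high (count_size _ _).
  have /allP q_inr : all (fun j => is_inr (q j)) e.
    by rewrite all_count eqn_leq count_size size_e (leq_trans _ high) ?wd.
  pose tau j := if q j is inr i' then i' else i.
  have qE j : q j = inr (tau j).
    by have := q_inr j (mem_enum _ _); rewrite /tau; case: (q j).
  pose s := [seq enum_rank (tau j, tnth (in_tuple w) j) | j <- e].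
  have coefE : @coef w q = f (\prod_(b <- s) letters b).
    rewrite /coef /s big_map /e; congr (f _).
    rewrite [index_enum _]unlock -enumT; apply: eq_bigr => j _.
    by rewrite /letters enum_rankK /= -qE.
  have [s_t0|/eqP s_t0] := eqVneq s (t0 : seq _); last first.
    left; rewrite /term coefE f0 ?scale0r //; first by case: sS.
    by rewrite size_map size_e.
  right.
  have w_w0 : w = w0.
    apply: val_inj => /=.
    have := congr1 (map (fun a => (enum_val a).2)) s_t0.
    rewrite /= -!map_comp; under eq_map => j do rewrite /= enum_rankK /=.
    rewrite -enumT map_tnth_enum /= => ->.
    by under eq_map => l do rewrite /= enum_rankK /=; rewrite map_id.
  have tau_i j : tau j = i.
    have := congr1 (map (fun a => (enum_val a).1)) s_t0.
    rewrite /= -!map_comp; under eq_map => j' do rewrite /= enum_rankK /=.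
    under [in RHS]eq_map => l do rewrite /= enum_rankK /=.
    move=> tauE; have : tau j \in [seq tau j' | j' <- Finite.enum 'I_(size w)].
      by apply: map_f; rewrite -enumT mem_enum.
    by rewrite tauE => /mapP [].
  by split=> //; apply/ffunP => j; rewrite ffunE qE tau_i.
pose q0 : {ffun 'I_(size w0) -> 'I_N + 'I_p} := [ffun=> inr i].
have term0 : @term w0 q0 = x (inr i) ^+ d.
  have -> : @term w0 q0 = 1 *: mon x (nseq d (inr i)).
    congr (_ *: mon x _).
      rewrite -[RHS]f1 /coef /t0 big_map [in RHS]big_tnth; congr (f _).
      by apply: eq_bigr => j _; rewrite /letters enum_rankK ffunE.
    rewrite -w0d -[in RHS](size_enum_ord (size w0)).
    by elim: (enum _) => //= j e ->; rewrite ffunE.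
  by rewrite scale1r mon_nseq.
have Q_w0 : Q@_w0 != 0 by rewrite mcoeff_neq0.
rewrite (bigD1_seq w0) //= ?fset_uniq // in Q0.
have {}Q0 : x (inr i) ^+ d = - (\sum_(q | q != q0) @term w0 q) -
    (Q@_w0)^-1 *: \sum_(w <- msupp Q | w != w0) Q@_w *: F w.
  move: Q0 => /(congr1 (fun g => (Q@_w0)^-1 *: g)).
  rewrite scalerDr scalerA mulVf // scale1r scaler0.
  rewrite /F (bigD1 q0) //= term0 -addrA => /eqP; rewrite addr_eq0 => /eqP ->.
  by rewrite opprD.
rewrite Q0 -/S; apply: (@subspaceB _ _ S _ _ sS).
  rewrite -scaleN1r; apply: (@subspaceZ _ _ S _ _ sS).
  apply: (@subspace_sum _ _ S _ _ _ _ sS) => q q_q0.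
  by have [//|[_ qE]] := termS w0 q w0Q; rewrite qE eqxx in q_q0.
apply: (@subspaceZ _ _ S _ _ sS); rewrite big_seq_cond.
apply: (@subspace_sum _ _ S _ _ _ _ sS) => w /andP [wQ w_w0].
apply: (@subspaceZ _ _ S _ _ sS); apply: (@subspace_sum _ _ S _ _ _ _ sS) => q _.
by have [//|[ww0 _]] := termS w q wQ; rewrite ww0 eqxx in w_w0.
Qed.
End Relation.

(** * Dependence of words under an almost identity *)

Lemma degree_span_prod (k : fieldType) (Y : Type) (I J : finType)
    (x : I -> Y -> k^o) (F : J -> Y -> k^o) (c : J -> nat) :
  (forall j, degree_span x (c j) (F j)) ->
  degree_span x (\sum_j c j) (\prod_j F j).
Proof.
move=> cF; elim/big_rec2: _ => [|j L f _ Lf]; first exact: degree_span_cst.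
exact: degree_spanM.
Qed.

(** The left side grows like [L ^ N], the right side like [L ^ (e + c + 1)], and
    [L] is taken just above the ratio of the constants. *)
Lemma growth_bound (D d c e N : nat) : (N <= e + c)%N ->
  exists L, ((D * L).+1 ^ N * d ^ c.+1 < L ^ e * L ^ c.+1)%N.
Proof.
move=> Nec; pose L := ((D.+1 ^ N * d ^ c.+1).+1)%N; exists L.
have L1 : (D * L < D.+1 * L)%N by rewrite mulSn addnC -addn1 leq_add2l.
apply: (@leq_ltn_trans ((D.+1 * L) ^ N * d ^ c.+1)).
  by rewrite leq_mul //; elim: (N) => // m IHm; rewrite !expnS leq_mul.
rewrite -expnD addnS [(L ^ _.+1)%N]expnS expnMn mulnAC.
apply: (@leq_trans (L * L ^ N)); last by rewrite leq_mul2l leq_pexp2l.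
by rewrite ltn_mul2r expn_gt0 ltnSn.
Qed.

(** Words in the letters [r] are linearly dependent whenever [Q] is an almost
    identity: the relations coming from [Q] would leave too few functions on its
    zero set. *)
Lemma words_dependent (k : closedFieldType) (c d n : nat) (Q : ncpoly k n)
    (R : algType k) (r : 'I_#|{: 'I_c.+1 * 'I_n}| -> R) :
    has_degree Q d ->
    codim_le [set v : {ffun 'I_n -> R} | nc_eval Q v = 0]%classic c ->
  exists t : d.-tuple 'I_#|{: 'I_c.+1 * 'I_n}|,
    linear_span [set a | exists2 t' : d.-tuple 'I_#|{: 'I_c.+1 * 'I_n}|,
        t' != t & a = \prod_(b <- t') r b]%classic
      (\prod_(b <- t) r b).
Proof.
move=> degQ [V1 [V2 [W [h [X [[sV1 _ dec] [_ hV2] _ [e [chain _] dimW] zeroQ]]]]]].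
apply: contrapT => /forallNP free_words.
pose v (i : 'I_c.+1) : {ffun 'I_n -> R} := [ffun l => r (enum_rank (i, l))].
have /choice [aw awP] (i : 'I_c.+1) :
    exists aw : {ffun 'I_n -> R} * W, V1 aw.1 /\ v i = aw.1 + h aw.2.
  have [[a b] [[/= V1a V2b ->] _]] := dec (v i).
  by move: V2b; rewrite -hV2 => -[w _ <-]; exists (a, w).
pose Y := ({z : W | X z} * (nat -> k))%type.
(* With this shift the point [h (shift y) + \sum_i tau_i v_i] equals
   [\sum_i tau_i (aw i).1 + h z], a zero of [Q] because [V1 + h X] consists of
   zeros. *)
pose shift (y : Y) : W := sval y.1 - \sum_(i < c.+1) y.2 i *: (aw i).2.
pose x (z : 'I_(\dim {:W}) + 'I_c.+1) (y : Y) : k^o :=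
  match z with inl j => vcoord j (shift y) | inr i => y.2 i end.
pose u (z : 'I_(\dim {:W}) + 'I_c.+1) (l : 'I_n) : R :=
  match z with inl j => h (vbasis {:W})`_j l | inr i => v i l end.
have zeroQx y : nc_eval Q (fun l => \sum_z x z y *: u z l) = 0.
  have := zeroQ (\sum_(i < c.+1) y.2 i *: (aw i).1) (sval y.1).
  have -> : (fun l => \sum_z x z y *: u z l) =
      (\sum_(i < c.+1) y.2 i *: (aw i).1 + h (sval y.1) : {ffun 'I_n -> R}).
    transitivity (h (shift y) + \sum_(i < c.+1) y.2 i *: v i : 'I_n -> R).
      apply/funext => l; rewrite [shift y]vcoord_sum linear_sum ffunE !sum_ffunE.
      rewrite big_sumType; congr (_ + _); apply: eq_bigr => j _ /=.
        by rewrite linearZ ffunE.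
      by rewrite !ffunE.
    congr fun_of_fin; rewrite linearB linear_sum addrAC -addrA addrC; congr (_ + _).
    rewrite -sumrB; apply: eq_bigr => i _.
    by rewrite (awP i).2 linearZ scalerDr addrK.
  apply; last exact: svalP.
  apply: subspace_sum => // i _; apply: subspaceZ => //.
  exact: (awP i).1.
have lettersE : letters u = r.
  by apply/funext => b; rewrite /letters /u ffunE -surjective_pairing enum_valK.
have rel := power_in_low_monomials degQ zeroQx.
rewrite lettersE in rel; have {}rel := rel free_words.
have [D HD] := irreducible_chain_free chain.
have [L ltL] := growth_bound (D + c.+1) d dimW.
have [J [phi [cardJ Dphi free_phi]]] := HD L.
have [J' [b [m [cardJ' mL free_J']]]] := free_on_free_variables L c.+1 free_phi.
suff : (#|J'| <= ((D + c.+1) * L).+1 ^ \dim {:W} * d ^ c.+1)%N.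
  by rewrite leqNgt cardJ' cardJ ltL.
pose psi j (y : Y) : k := phi (b j) (sval y.1) * \prod_(i < c.+1) y.2 i ^+ m j i.
apply: (free_on_card_reduced rel (phi := psi)) => [j|a rel_a].
  have -> : (psi j : Y -> k^o) =
      ((phi (b j) : W -> k^o) \o (fun y : Y => sval y.1)) *
      \prod_(i < c.+1) x (inr i) ^+ m j i.
    apply/funext => y; rewrite fctE fct_prodE; congr (_ * _).
    by apply: eq_bigr => i _; rewrite fctE.
  rewrite mulnDl; apply: degree_spanM.
    apply: degree_span_comp (Dphi _) => i.
    have -> : (vcoord i \o fun y : Y => sval y.1) =
        x (inl i) + \sum_(i' < c.+1) vcoord i (aw i').2 *: x (inr i').
      apply/funext => y; rewrite !fctE fct_sumE /= /vcoord /shift linearB linear_sum.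
      rewrite -addrA addrC -[LHS]add0r; congr (_ + _).
      rewrite addrC -sumrB big1 // => i' _.
      by rewrite linearZ /= !fctE -[_ *: _]/(_ * _) mulrC subrr.
    apply: subspaceD (subspace_linear_span _) _ _; first exact: degree_spanX.
    apply: subspace_sum (subspace_linear_span _) _ => i' _.
    by apply: subspaceZ (subspace_linear_span _) _; apply: degree_spanX.
  apply: (@degree_spanS _ _ _ _ (\sum_(i < c.+1) m j i)).
    by rewrite -[X in (_ <= X * _)%N]card_ord -sum_nat_const leq_sum.
  apply: degree_span_prod => i.
  by have := degree_span_exp (c := m j i) (degree_spanX (x := x) (inr i)); rewrite muln1.
apply: free_J' => -[z tau] /= Xz.
exact: (rel_a (exist _ z Xz, tau) I).
Qed.

Theorem theorem1 (k : closedFieldType) (c d n : nat)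
    (hc : (0 < c)%N) (hd : (0 < d)%N) (hn : (0 < n)%N) :
  exists (m : nat) (P : ncpoly k m),
    P <> 0 /\
    forall (Q : ncpoly k n) (R : algType k),
      has_degree Q d -> almost_identity c Q R ->
      forall r : 'I_m -> R, nc_eval P r = 0.
Proof.
exists #|{: 'I_c.+1 * 'I_n}|, (words_standard k d _).
split=> [|Q R degQ [_ codimQ] r]; first exact: words_standard_neq0.
have [t tP] := words_dependent r degQ codimQ.
rewrite nc_eval_words_standard.
exact: (@standard_sum_dependent _ _ _ _ t).
Qed.
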